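(* Let $A,B\in\mathbb{R}^{m\times n}$ and $\ell:=\min\{m,n\}$. Suppose there exists a nonsingular matrix $M\in\mathbb{R}^{m\times m}$ such that $\sigma_\ell(MA)>\|MB\|_2$. Then the following hold. (i) If $m<n$, then the equation $Ax-B|x|=b$ is solvable for every $b\in\mathbb{R}^m$. (ii) If $m=n$, then the equation $Ax-B|x|=b$ has a unique solution for every $b\in\mathbb{R}^m$. (iii) If $m>n$ and $b\in\mathbb{R}^m$ is such that the solution set $\mathcal{X}^*=\{x\in\mathbb{R}^n : Ax-B|x|=b\}$ is non-empty, then $\mathcal{X}^*$ is a singleton.
   Context: For $x\in\mathbb{R}^n$, $|x|=(|x_1|,\ldots,|x_n|)^\top$ is the componentwise absolute value. For $C\in\mathbb{R}^{m\times n}$, $\sigma_1(C)\ge\sigma_2(C)\ge\cdots\ge\sigma_{\min\{m,n\}}(C)\ge 0$ are the singular values of $C$, and $\|C\|_2=\sigma_1(C)$ is the spectral norm. *)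

(* Defs.v *)
From HB Require Import structures.
From mathcomp Require Import all_boot all_order all_algebra.
From mathcomp Require Import classical_sets reals polyrcf.

Set Implicit Arguments.
Unset Strict Implicit.
Unset Printing Implicit Defensive.

Import Order.TTheory GRing.Theory Num.Theory.
Local Open Scope ring_scope.
Local Open Scope classical_set_scope.

(* Not `|x|, which on matrices can denote the sup norm. *)
Definition absmx (R : realType) (m n : nat) (x : 'M[R]_(m, n)) : 'M[R]_(m, n) :=
  map_mx (fun t : R => `|t|) x.

(* Each root is repeated according to its algebraic multiplicity. *)
Definition real_eigenvalues (R : realType) (n : nat) (S : 'M[R]_n) : seq R :=
  flatten [seq nseq (mup a (char_poly S)) a | a <- rootsR (char_poly S)].

(* C^T C has n eigenvalues, of which the min(m, n) largest are kept: when
   m < n the n - m remaining ones are zero. *)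
Definition singular_values (R : realType) (m n : nat) (C : 'M[R]_(m, n)) : seq R :=
  take (minn m n)
    (sort >=%R [seq Num.sqrt a | a <- real_eigenvalues (C^T *m C)]).

(* 1-based: meaningful for 1 <= k <= minn m n only. *)
Definition sigma (R : realType) (m n : nat) (k : nat) (C : 'M[R]_(m, n)) : R :=
  (singular_values C)`_k.-1.

Definition spectral_norm (R : realType) (m n : nat) (C : 'M[R]_(m, n)) : R :=
  sigma 1 C.

Definition solution_set (R : realType) (m n : nat) (A B : 'M[R]_(m, n))
    (b : 'cV[R]_m) : set 'cV[R]_n :=
  [set x | A *m x - B *m absmx x = b].

(* Main.v *)
Require Import Defs.
From HB Require Import structures.
From mathcomp Require Import all_boot all_order all_algebra.
From mathcomp Require Import classical_sets reals polyrcf.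
From mathcomp Require Import spectral complex functions.
From mathcomp Require Import interval_inference topology normedtype sequences.
From mathcomp Require Import ring lra.

Set Implicit Arguments.
Unset Strict Implicit.
Unset Printing Implicit Defensive.

Import Order.TTheory GRing.Theory Num.Theory.
Import numFieldNormedType.Exports.
Local Open Scope ring_scope.
Local Open Scope classical_set_scope.

(** Multiplying the equation by the nonsingular matrix [M] does not change its
    solutions, so only [MA] and [MB] matter. Write [s] for the least singular
    value of [MA] and [t] for the spectral norm of [MB]; since [|x| - |y|] is
    entrywise dominated by [x - y], the map [x |-> MB|x|] is [t]-Lipschitz for
    the Euclidean norm, and [t < s].

    If [n <= m], then [MA] expands Euclidean lengths by at least [s]
    ([nsq_sigma_ge]). For two solutions, [MA(x - y) = MB(|x| - |y|)] gives
    [s ||x - y|| <= t ||x - y||], whence [x = y] ([ave_injective]).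

    If [m <= n], it is the transpose of [MA] that expands lengths by at least
    [s] ([nsq_sigma_tr_ge]). Hence the pseudo-inverse [W] is a right inverse
    of [MA] that expands lengths by at most [1/s] ([right_inverse_bound]),
    the map [x |-> W(Mb + MB|x|)] is a [t/s]-contraction, and its fixed point
    is a solution ([ave_solvable]).

    The link between singular values and lengths is the spectral theorem for
    the Gram matrix [C^T C], obtained from the unitary diagonalization over
    the complex numbers ([sym_spectral]). Passing from [C] to its transpose
    uses that [C^T C] and [C C^T] have the same nonzero eigenvalues with the
    same multiplicities ([char_poly_mulmxC]).

    Everything is phrased with the squared Euclidean norm [nsq]: all the
    estimates above are homogeneous of degree two, so neither square roots of
    lengths nor the triangle inequality come up. *)

(** * Characteristic polynomials and lists of eigenvalues *)

(** Sylvester's identity: both sides are the determinant of the block matrix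
    with rows [X, A] and [B, 1], times ['X^n], once cleared below the
    diagonal by column operations and once above it. *)
Lemma char_poly_mulmxC (R : comNzRingType) (m n : nat)
    (A : 'M[R]_(m, n)) (B : 'M[R]_(n, m)) :
  char_poly (A *m B) * 'X^n = 'X^m * char_poly (B *m A).
Proof.
rewrite /char_poly /char_poly_mx !map_mxM.
set a := map_mx _ A; set b := map_mx _ B.
pose Q := block_mx ('X%:M : 'M_m) a b (1%:M : 'M_n).
have detQ : \det Q = \det ('X%:M - a *m b).
  have <- : \det (Q *m block_mx 1%:M 0 (- b) 1%:M) = \det Q.
    by rewrite det_mulmx det_lblock !det1 !mulr1.
  rewrite mulmx_block !(mulmx1, mul1mx, mulmx0, mulmxN, add0r) subrr.
  by rewrite det_ublock det1 mulr1.
have <- : \det (block_mx (1%:M : 'M_m) (- a) 0 ('X%:M : 'M_n)) = 'X^n.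
  by rewrite det_ublock det1 mul1r det_scalar.
rewrite -detQ -det_mulmx mulmx_block.
rewrite !(mulmx1, mul1mx, mulmx0, mulmxN, addr0) mul_scalar_mx mul_mx_scalar.
by rewrite addNr det_lblock det_scalar addrC.
Qed.

Lemma perm_real_eigenvalues (R : realType) (n : nat) (S : 'M[R]_n) (s : seq R) :
  char_poly S = \prod_(a <- s) ('X - a%:P) -> perm_eq (real_eigenvalues S) s.
Proof.
move=> charS; rewrite /real_eigenvalues charS.
set p := \prod_(a <- s) _.
have p0 : p != 0 by rewrite monic_neq0 ?monic_prod_XsubC.
apply/allP => x _ /=; apply/eqP.
rewrite -[RHS]mu_prod_XsubC -/p count_flatten -map_comp.
under eq_map => a do rewrite /= count_nseq /= mulnbl.
have [xr|xNr] := boolP (x \in rootsR p).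
  rewrite sumnE big_map (bigD1_seq x) ?uniq_roots //= eqxx big1 ?addn0 //.
  by move=> a /negPf ->.
rewrite mupNroot; last first.
  by have := roots_on_rootsR p0 x; rewrite /= => ->.
rewrite sumnE big_map big1_seq // => a /andP[_ ar].
by case: eqP ar xNr => // -> ->.
Qed.

(** * The squared Euclidean norm and the spectral theorem *)

Definition nsq (R : pzRingType) (n : nat) (x : 'cV[R]_n) : R := (x^T *m x) 0 0.

Lemma nsqE (R : realDomainType) (n : nat) (x : 'cV[R]_n) : nsq x = \sum_i x i 0 ^+ 2.
Proof. by rewrite /nsq mxE; apply: eq_bigr => i _; rewrite mxE expr2. Qed.

Lemma nsq_ge0 (R : realDomainType) (n : nat) (x : 'cV[R]_n) : 0 <= nsq x.
Proof. by rewrite nsqE sumr_ge0 // => i _; rewrite sqr_ge0. Qed.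

Lemma nsq_le0 (R : realDomainType) (n : nat) (x : 'cV[R]_n) : nsq x <= 0 -> x = 0.
Proof.
rewrite nsqE => x0; apply/colP => i; rewrite mxE; apply/eqP.
rewrite -sqrf_eq0 eq_le sqr_ge0 andbT (le_trans _ x0) //.
by rewrite (bigD1 i) //= lerDl sumr_ge0 // => j _; rewrite sqr_ge0.
Qed.

Lemma nsq_mulmx (R : comPzRingType) (m n : nat) (C : 'M[R]_(m, n)) (x : 'cV[R]_n) :
  nsq (C *m x) = (x^T *m (C^T *m C) *m x) 0 0.
Proof. by rewrite /nsq trmx_mul !mulmxA. Qed.

(** The weights [w i] are the squared moduli of the coordinates of [x] in a
    unitary eigenbasis of [S]. Exposing only these nonnegative weights, and not
    the basis, keeps the complex numbers inside the proof: any bound on the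
    eigenvalues yields a bound on the quadratic form by comparing sums. *)
Lemma sym_spectral (R : rcfType) (n : nat) (S : 'M[R]_n) : S^T = S ->
  exists d : 'I_n -> R,
    char_poly S = \prod_(a <- codom d) ('X - a%:P) /\
    forall x : 'cV[R]_n, exists w : 'I_n -> R,
      [/\ forall i, 0 <= w i, nsq x = \sum_i w i
        & (x^T *m S *m x) 0 0 = \sum_i d i * w i].
Proof.
move=> symS.
pose f := real_complex R.
pose Sc := map_mx f S.
have Sc_real : Sc \is a realmx.
  by apply/mxOverP => i j; rewrite mxE complex_real.
have Sc_herm : Sc \is hermsymmx.
  apply: realsym_hermsym => //; apply/is_hermitianmxP.
  by rewrite expr0 scale1r map_mx_id // map_trmx symS.
have /hermitian_normalmx/orthomx_spectralP := Sc_herm.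
have := hermitian_spectral_diag_real Sc_herm.
have := spectral_unitarymx Sc.
set P := spectralmx Sc; set D := spectral_diag Sc.
move=> Pu /mxOverP D_real ScE.
have Punit := unitarymx_unit Pu.
pose d i := complex.Re (D 0 i).
have dE i : f (d i) = D 0 i by rewrite /f RRe_real.
exists d; split.
  apply: (map_poly_inj f); rewrite map_char_poly -/Sc.
  rewrite rmorph_prod /= big_map.
  under eq_bigr => i _ do rewrite map_polyXsubC.
  have -> : char_poly Sc = char_poly (diag_mx D).
    rewrite /char_poly /char_poly_mx ScE !map_mxM.
    have PP : map_mx polyC (invmx P) *m map_mx polyC P = 1%:M.
      by rewrite -map_mxM mulVmx // map_mx1.
    have -> : 'X%:M - map_mx polyC (invmx P) *m map_mx polyC (diag_mx D) *m
         map_mx polyC P =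
       map_mx polyC (invmx P) *m ('X%:M - map_mx polyC (diag_mx D)) *m
         map_mx polyC P.
      rewrite mulmxBr mulmxBl; congr (_ - _).
      by rewrite scalar_mxC -mulmxA PP mulmx1.
    by rewrite !det_mulmx mulrAC -det_mulmx PP det1 mul1r.
  rewrite char_poly_trig ?diag_mx_is_trig // big_enum /=.
  by apply: eq_bigr => i _; rewrite mxE eqxx mulr1n -dE.
move=> x; pose y := P *m map_mx f x.
pose w i := complex.Re (`|y i 0| ^+ 2).
have wE i : f (w i) = `|y i 0| ^+ 2.
  by rewrite /f RRe_real // ger0_real // exprn_ge0.
(* Both sums are the same form in [x]: [e = 1] gives the length and [e = D]
   the quadratic form of [S]. *)
have quad (e : 'rV[R[i]]_n) :
    ((map_mx f x)^T *m (invmx P *m diag_mx e *m P) *m map_mx f x) 0 0 =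
    \sum_i e 0 i * `|y i 0| ^+ 2.
  have xtP : (map_mx f x)^T *m invmx P = map_mx Num.conj y^T.
    rewrite invmx_unitary // /y trmx_mul map_mxM; congr (_ *m _).
    by apply/matrixP => i j; rewrite !mxE; apply/esym/CrealP; rewrite complex_real.
  rewrite 2!mulmxA xtP -mulmxA.
  rewrite mxE; apply: eq_bigr => i _.
  by rewrite mul_mx_diag !mxE normCKC mulrA [_ * e _ _]mulrC.
exists w; split.
- by move=> i; rewrite -lecR -/f wE exprn_ge0.
- apply: (@complexI R); rewrite rmorph_sum /=.
  under [RHS]eq_bigr => i _ do rewrite -/(f _) wE.
  have := quad (const_mx 1); rewrite diag_const_mx mulmx1 mulVmx // mulmx1.
  rewrite map_trmx -map_mxM mxE => ->.
  by apply: eq_bigr => i _; rewrite mxE mul1r.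
- apply: (@complexI R); rewrite rmorph_sum /=.
  under [RHS]eq_bigr => i _ do rewrite rmorphM /= -!/(f _) wE dE.
  by rewrite -quad -ScE /Sc map_trmx -!map_mxM [RHS]mxE.
Qed.

Lemma gram_spectral (R : rcfType) (m n : nat) (C : 'M[R]_(m, n)) :
  exists d : 'I_n -> R,
    char_poly (C^T *m C) = \prod_(a <- codom d) ('X - a%:P) /\
    forall x : 'cV[R]_n, exists w : 'I_n -> R,
      [/\ forall i, 0 <= w i, nsq x = \sum_i w i
        & nsq (C *m x) = \sum_i d i * w i].
Proof.
have [|d [dE dP]] := @sym_spectral R n (C^T *m C).
  by rewrite trmx_mul trmxK.
exists d; split=> // x; have [w [w0 w1 w2]] := dP x.
by exists w; split=> //; rewrite nsq_mulmx.
Qed.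

Lemma size_real_eigenvalues_gram (R : realType) (m n : nat) (C : 'M[R]_(m, n)) :
  size (real_eigenvalues (C^T *m C)) = n.
Proof.
have [d [/perm_real_eigenvalues/perm_size -> _]] := gram_spectral C.
by rewrite size_codom card_ord.
Qed.

Lemma nsq_mulmx_le (R : realType) (m n : nat) (C : 'M[R]_(m, n)) (c : R)
    (x : 'cV[R]_n) :
  all (fun a => a <= c) (real_eigenvalues (C^T *m C)) ->
  nsq (C *m x) <= c * nsq x.
Proof.
have [d [/perm_real_eigenvalues/perm_all -> /(_ x)[w [w0 -> ->]]]] :=
  gram_spectral C.
move=> /allP dc; rewrite mulr_sumr; apply: ler_sum => i _.
by rewrite ler_wpM2r // dc // codom_f.
Qed.

Lemma nsq_mulmx_ge (R : realType) (m n : nat) (C : 'M[R]_(m, n)) (c : R)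
    (x : 'cV[R]_n) :
  all (fun a => c <= a) (real_eigenvalues (C^T *m C)) ->
  c * nsq x <= nsq (C *m x).
Proof.
have [d [/perm_real_eigenvalues/perm_all -> /(_ x)[w [w0 -> ->]]]] :=
  gram_spectral C.
move=> /allP dc; rewrite mulr_sumr; apply: ler_sum => i _.
by rewrite ler_wpM2r // dc // codom_f.
Qed.

(** The spectra of [C C^T] and [C^T C] differ only by copies of [0], which
    [p] does not see. *)
Lemma count_real_eigenvalues_gram_tr (R : realType) (m n : nat) (C : 'M[R]_(m, n))
    (p : pred R) :
  ~~ p 0 ->
  count p (real_eigenvalues (C *m C^T)) = count p (real_eigenvalues (C^T *m C)).
Proof.
move=> /negPf p0.
have [d [dE _]] := gram_spectral C.
have [e [eE _]] := gram_spectral C^T; rewrite trmxK in eE.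
have Xprod k : 'X^k = \prod_(a <- nseq k (0 : R)) ('X - a%:P).
  by rewrite big_nseq polyC0 subr0 iter_mulr_1.
have := char_poly_mulmxC C^T C; rewrite dE eE !Xprod -!big_cat /=.
move=> /prod_XsubC_eq/permP/(_ p).
rewrite !count_cat !count_nseq p0 !mul0n addn0 add0n => de.
by rewrite (permP (perm_real_eigenvalues dE)) (permP (perm_real_eigenvalues eE)).
Qed.

(** * Singular values and the stretching of lengths *)

Lemma nth_sorted_ge (R : realDomainType) (s : seq R) (i j : nat) :
  sorted >=%R s -> (i <= j < size s)%N -> s`_j <= s`_i.
Proof.
move=> ss /andP[ij js].
have ge_trans : transitive (>=%R : rel R) by move=> y x z yx zy; exact: le_trans yx.
by apply: (sorted_leq_nth ge_trans lexx 0 ss); rewrite ?inE // (leq_ltn_trans ij).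
Qed.

Lemma nth_sorted_count (R : realDomainType) (s : seq R) (k : nat) :
  sorted >=%R s -> (k < size s)%N -> (k < count (fun a => s`_k <= a)%R s)%N.
Proof.
move=> ss ks; rewrite -[s in count _ s](cat_take_drop k.+1) count_cat.
suff /eqP -> : count (fun a => s`_k <= a) (take k.+1 s) == size (take k.+1 s).
  by rewrite size_takel // ltnS leq_addr.
rewrite -all_count; apply/(all_nthP 0) => i.
rewrite size_takel // => ik; rewrite nth_take //.
by apply: nth_sorted_ge => //; rewrite -ltnS ik.
Qed.

(** Counting the eigenvalues above a threshold depends only on the spectrum as a
    multiset. This is what lets a lower bound on the [k]-th singular value of
    [C] be transferred to the spectrum of [C C^T]. Positivity of [sigma k C]
    rules out the default value that [sigma] takes past the end of the list. *)
Lemma sigma_count (R : realType) (m n k : nat) (C : 'M[R]_(m, n)) :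
  (0 < k)%N -> 0 < sigma k C ->
  (k <= count (fun a => sigma k C <= Num.sqrt a)%R
          (real_eigenvalues (C^T *m C)))%N.
Proof.
case: k => // k _; rewrite /sigma /singular_values /=.
set s := sort _ _; set l := minn m n => s0.
have ksl : (k < size (take l s))%N.
  by rewrite ltnNge; apply: contraTN s0 => ?; rewrite nth_default ?ltxx.
have kl : (k < l)%N by rewrite (leq_trans ksl) // size_take; case: ltnP => // ->.
rewrite nth_take // -count_map /=.
rewrite -(permP (permEl (perm_sort >=%R _))) -/s.
apply: nth_sorted_count; last first.
  by rewrite (leq_trans ksl) // size_take; case: ltnP => // /ltnW.
apply: sort_sorted => x y; exact: le_total.
Qed.

Lemma sigma_ge0 (R : realType) (m n k : nat) (C : 'M[R]_(m, n)) : 0 <= sigma k C.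
Proof.
rewrite /sigma; have [ks|ks] := ltnP k.-1 (size (singular_values C)); last first.
  by rewrite nth_default.
have := mem_nth 0 ks; move: (nth _ _ _) => a /mem_take; rewrite mem_sort.
by move=> /mapP[b _ ->]; exact: sqrtr_ge0.
Qed.

Lemma ge_sqrtr (R : rcfType) (a c : R) : Num.sqrt a <= c -> a <= c ^+ 2.
Proof.
move=> ac; have [a0|/ltW a0] := leP 0 a; last exact: le_trans (sqr_ge0 _).
by rewrite -[a]sqr_sqrtr // ler_pXn2r // nnegrE ?(le_trans _ ac) ?sqrtr_ge0.
Qed.

Lemma nsq_spectral_norm (R : realType) (m n : nat) (C : 'M[R]_(m, n))
    (x : 'cV[R]_n) : (0 < m)%N -> (0 < n)%N ->
  nsq (C *m x) <= spectral_norm C ^+ 2 * nsq x.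
Proof.
move=> m0 n0; apply: nsq_mulmx_le; apply/allP => a aC; apply: ge_sqrtr.
rewrite /spectral_norm /sigma /singular_values nth_take ?leq_min ?m0 //.
set s := sort _ _.
have : Num.sqrt a \in s by rewrite mem_sort map_f.
move=> /(nthP 0)[i si <-]; apply: nth_sorted_ge; last by rewrite leq0n.
by apply: sort_sorted => z y; exact: le_total.
Qed.

Lemma le_sqrtr (R : rcfType) (a c : R) : 0 < c -> c <= Num.sqrt a -> c ^+ 2 <= a.
Proof.
move=> c0 ca; have /ltW a0 : 0 < a by rewrite -sqrtr_gt0 (lt_le_trans c0).
by rewrite -[a]sqr_sqrtr // ler_pXn2r // nnegrE ?sqrtr_ge0 ?ltW.
Qed.

(** There are exactly [n] eigenvalues of [C^T C], and at least [n] of them lie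
    above the square of the [n]-th singular value. *)
Lemma nsq_sigma_ge (R : realType) (m n : nat) (C : 'M[R]_(m, n)) (x : 'cV[R]_n) :
  (0 < n <= m)%N -> 0 < sigma (minn m n) C ->
  sigma (minn m n) C ^+ 2 * nsq x <= nsq (C *m x).
Proof.
move=> /andP[n0 nm]; rewrite (minn_idPr nm) => s0; apply: nsq_mulmx_ge.
have := sigma_count n0 s0; rewrite -{1}(size_real_eigenvalues_gram C).
move=> sc; have: all (fun a => sigma n C <= Num.sqrt a) (real_eigenvalues (C^T *m C)).
  by rewrite all_count eqn_leq count_size.
by apply: sub_all => a; exact: le_sqrtr.
Qed.

(** [C^T C] has [n >= m] eigenvalues, of which at least [m] lie above the
    threshold. As the threshold is positive, these are eigenvalues of the
    [m x m] matrix [C C^T], hence all of them. *)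
Lemma nsq_sigma_tr_ge (R : realType) (m n : nat) (C : 'M[R]_(m, n))
    (y : 'cV[R]_m) :
  (0 < m <= n)%N -> 0 < sigma (minn m n) C ->
  sigma (minn m n) C ^+ 2 * nsq y <= nsq (C^T *m y).
Proof.
move=> /andP[m0 mn]; rewrite (minn_idPl mn) => s0; apply: nsq_mulmx_ge.
rewrite trmxK; have := sigma_count m0 s0.
rewrite -count_real_eigenvalues_gram_tr; last first.
  by rewrite sqrtr0 -ltNge.
have := size_real_eigenvalues_gram C^T; rewrite trmxK => sz; rewrite -{1}sz.
move=> sc; have: all (fun a => sigma m C <= Num.sqrt a) (real_eigenvalues (C *m C^T)).
  by rewrite all_count eqn_leq count_size.
by apply: sub_all => a; exact: le_sqrtr.
Qed.

(** * Fixed points of Euclidean contractions *)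

(** [`|x|] is the maximum norm of the column [x]. *)
Lemma normr_cV_sqr_le (R : realType) (n : nat) (x : 'cV[R]_n) :
  `|x| ^+ 2 <= nsq x.
Proof.
have [->|x0] := eqVneq x 0; first by rewrite normr0 expr0n nsq_ge0.
have /mx_norm_neq0[[i j] /= xE] : mx_norm x != 0 by rewrite (normr_eq0 x).
rewrite (_ : `|x| = mx_norm x) // xE /= ord1 nsqE (bigD1 i) //= real_normK ?num_real //.
by rewrite lerDl sumr_ge0 // => k _; rewrite sqr_ge0.
Qed.

Lemma nsq_le_normr (R : realType) (n : nat) (x : 'cV[R]_n) :
  nsq x <= n%:R * `|x| ^+ 2.
Proof.
rewrite nsqE -[n in n%:R]card_ord mulr_natl -sumr_const; apply: ler_sum => i _.
rewrite -real_normK ?num_real // ler_pXn2r ?nnegrE //.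
rewrite {2}/Num.Def.normr /= mx_normrE.
exact: (le_bigmax_cond 0 (fun ij : 'I_n * 'I_1 => `|x ij.1 ij.2|) (j := (i, 0))).
Qed.

(** Joins two known structures on column vectors: the complete uniform space
    and the normed module. *)
HB.instance Definition _ (R : realType) (n : nat) := Complete.on 'cV[R]_n.

(** Banach's theorem applies to the maximum norm, for which [f] need not be a
    contraction. The two norms being equivalent, a high iterate of [f] is one;
    its fixed point [p] is also fixed by [f], since that iterate contracts the
    Euclidean distance between [f p] and [p] while preserving it. *)
Lemma nsq_contraction_fixpoint (R : realType) (n : nat)
    (f : 'cV[R]_n -> 'cV[R]_n) (q : R) :
  0 <= q < 1 -> (forall x y, nsq (f x - f y) <= q * nsq (x - y)) ->
  exists x, f x = x.
Proof.
move=> /andP[q0 q1] fq.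
have iter_fq k x y : nsq (iter k f x - iter k f y) <= q ^+ k * nsq (x - y).
  elim: k => [|k IHk]; first by rewrite mul1r.
  by rewrite (le_trans (fq _ _)) // exprS -mulrA ler_wpM2l.
(* The bound [1/4] makes the iterate 1/2-Lipschitz; the exponent [k.+1] is
   positive so that [q ^+ k.+1 < 1] as well, even for [n = 0]. *)
have [k kq] : exists k, n%:R * q ^+ k.+1 <= 4^-1.
  have /cvgrPdist_le : n%:R * q ^+ k @[k --> \oo] --> (0 : R).
    by apply: cvg_geometric; rewrite ger0_norm.
  move=> /(_ 4^-1)[|N _ /(_ N.+1 (leqnSn N))]; first by rewrite invr_gt0.
  rewrite /= sub0r normrN ger0_norm; first by exists N.
  by rewrite mulr_ge0 ?exprn_ge0.
pose g := iter k.+1 f.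
have g_lip x y : `|g x - g y| <= 2^-1 * `|x - y|.
  rewrite -(@ler_pXn2r _ 2) ?nnegrE ?mulr_ge0 ?invr_ge0 //.
  rewrite (le_trans (normr_cV_sqr_le _)) // (le_trans (iter_fq k.+1 _ _)) //.
  rewrite (le_trans (ler_wpM2l _ (nsq_le_normr _))) ?exprn_ge0 //.
  rewrite mulrA exprMn ler_wpM2r ?exprn_ge0 // mulrC (le_trans kq) //.
  by rewrite exprVn -natrX.
pose G : {fun [set: 'cV[R]_n] >-> [set: 'cV[R]_n]} := totalfun_ setT g.
have [|||p _ pE] := @banach_fixed_point R 'cV[R]_n setT G.
- exists (2^-1)%:nng; split=> /=; first by rewrite invf_lt1 // ltr1n.
  by move=> [x y] _ /=; exact: g_lip.
- exact: closedT.
- by exists 0.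
have gp : iter k.+1 f p = p by rewrite [RHS]pE.
exists p; apply/eqP; rewrite -subr_eq0; apply/eqP/nsq_le0.
have := iter_fq k.+1 (f p) p; rewrite -iterSr iterS gp.
rewrite -subr_le0 -[X in X - _]mul1r -mulrBl pmulr_rle0 //.
by rewrite subr_gt0 exprn_ilt1.
Qed.

(** * The absolute value equation *)

Lemma nsq_absmx_sub (R : realType) (n : nat) (x y : 'cV[R]_n) :
  nsq (absmx x - absmx y) <= nsq (x - y).
Proof.
rewrite !nsqE; apply: ler_sum => i _; rewrite !mxE.
rewrite -[leLHS]real_normK ?num_real // -[leRHS]real_normK ?num_real //.
by rewrite ler_pXn2r ?nnegrE // ler_dist_dist.
Qed.

(** [W] is the pseudo-inverse [A^T G^-1], where [G = A A^T]. With [y = G^-1 w]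
    the square of the length of [W w] is the inner product of [y] and [w],
    and the bound follows by expanding the squared length of [w - s y]. Here [s]
    bounds squared lengths: it is the square of a singular value below. *)
Lemma right_inverse_bound (R : realFieldType) (m n : nat) (A : 'M[R]_(m, n)) (s : R) :
  0 < s -> (forall y : 'cV[R]_m, s * nsq y <= nsq (A^T *m y)) ->
  exists2 W : 'M[R]_(n, m),
    A *m W = 1%:M & forall w : 'cV[R]_m, s * nsq (W *m w) <= nsq w.
Proof.
move=> s0 sA; pose G := A *m A^T.
have Gu : G \in unitmx.
  rewrite -row_free_unit -kermx_eq0; apply/eqP/row_matrixP => j.
  rewrite row0; apply: trmx_inj; rewrite trmx0; set y := _^T.
  have Gy : A^T *m y = 0.
    apply: nsq_le0; rewrite nsq_mulmx trmxK -/G /y trmxK.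
    by rewrite -row_mul mulmx_ker row0 mul0mx mxE.
  apply: nsq_le0; rewrite -(pmulr_rle0 _ s0) (le_trans (sA y)) // Gy.
  by rewrite /nsq mulmx0 mxE.
exists (A^T *m invmx G) => [|w]; first by rewrite mulmxA mulmxV.
pose y := invmx G *m w.
have wE : w = G *m y by rewrite /y mulKVmx.
have yw : nsq (A^T *m y) = (y^T *m w) 0 0 by rewrite nsq_mulmx trmxK -mulmxA -wE.
rewrite -mulmxA -/y.
have wy : (w^T *m y) 0 0 = (y^T *m w) 0 0.
  by rewrite -[in RHS](trmxK w) -trmx_mul [RHS]mxE.
have := nsq_ge0 (w - s *: y).
have -> : nsq (w - s *: y) = nsq w - s * nsq (A^T *m y) *+ 2 + s ^+ 2 * nsq y.
  have trB : (w - s *: y)^T = w^T - s *: y^T by apply/matrixP => i j; rewrite !mxE.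
  rewrite yw /nsq trB mulmxBr !mulmxBl -!scalemxAr -!scalemxAl.
  have mxD (U V : 'M[R]_1) : (U + V) 0 0 = U 0 0 + V 0 0 by rewrite mxE.
  have mxN (U : 'M[R]_1) : (- U) 0 0 = - U 0 0 by rewrite mxE.
  have mxZ c (U : 'M[R]_1) : (c *: U) 0 0 = c * U 0 0 by rewrite mxE.
  by rewrite !(mxD, mxN, mxZ) wy; ring.
have := ler_wpM2l (ltW s0) (sA y); lra.
Qed.

(** The fixed points of [x |-> W (M b + M B |x|)] are solutions for every right
    inverse [W] of [M A]; taking the pseudo-inverse makes this map a
    contraction. *)
Lemma ave_solvable (R : realType) (m n : nat) (A B : 'M[R]_(m, n))
    (M : 'M[R]_m) (b : 'cV[R]_m) :
  (0 < m <= n)%N -> M \in unitmx ->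
  spectral_norm (M *m B) < sigma (minn m n) (M *m A) ->
  exists x : 'cV[R]_n, A *m x - B *m absmx x = b.
Proof.
move=> mn Mu gap; have /andP[m0 /(leq_trans m0) n0] := mn.
set s := sigma _ _ in gap; set t := spectral_norm _ in gap.
have t0 : 0 <= t := sigma_ge0 _ _.
have s0 : 0 < s := le_lt_trans t0 gap.
have s20 : 0 < s ^+ 2 by rewrite exprn_gt0.
have [|W AW WP] := @right_inverse_bound R m n (M *m A) _ s20.
  by move=> y; exact: nsq_sigma_tr_ge.
pose f x := W *m (M *m b + M *m B *m absmx x).
have [||x fx] := @nsq_contraction_fixpoint R n f (t ^+ 2 / s ^+ 2).
- apply/andP; split; first by rewrite divr_ge0 // sqr_ge0.
  by rewrite ltr_pdivrMr // mul1r ltr_pXn2r // nnegrE // ltW.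
- move=> x y; rewrite mulrAC ler_pdivlMr // mulrC /f -mulmxBr.
  rewrite (le_trans (WP _)) // opprD addrACA subrr add0r -mulmxBr.
  rewrite (le_trans (nsq_spectral_norm _ _ m0 n0)) //.
  by rewrite ler_wpM2l ?exprn_ge0 // nsq_absmx_sub.
exists x; apply: (can_inj (mulKmx Mu)).
by rewrite mulmxBr !mulmxA -{1}fx /f mulmxA AW mul1mx addrK.
Qed.

Lemma ave_injective (R : realType) (m n : nat) (A B : 'M[R]_(m, n))
    (M : 'M[R]_m) (x y : 'cV[R]_n) :
  (0 < n <= m)%N ->
  spectral_norm (M *m B) < sigma (minn m n) (M *m A) ->
  A *m x - B *m absmx x = A *m y - B *m absmx y -> x = y.
Proof.
move=> nm gap; have /andP[n0 /(leq_trans n0) m0] := nm.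
set s := sigma _ _ in gap; set t := spectral_norm _ in gap.
have t0 : 0 <= t := sigma_ge0 _ _.
have s0 : 0 < s := le_lt_trans t0 gap.
move=> xy.
have MAB : M *m A *m (x - y) = M *m B *m (absmx x - absmx y).
  rewrite -!mulmxA; congr (_ *m _); rewrite !mulmxBr.
  have -> : A *m x = A *m y - B *m absmx y + B *m absmx x by rewrite -xy subrK.
  by rewrite addrC !addrA addNr add0r addrC.
apply/eqP; rewrite -subr_eq0; apply/eqP/nsq_le0.
have st : 0 < s ^+ 2 - t ^+ 2.
  by rewrite subr_gt0 ltr_pXn2r // nnegrE // ltW.
rewrite -(pmulr_rle0 _ st) mulrBl subr_le0 (le_trans (nsq_sigma_ge _ nm s0)) //.
rewrite MAB (le_trans (nsq_spectral_norm _ _ m0 n0)) //.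
by rewrite ler_wpM2l ?exprn_ge0 // nsq_absmx_sub.
Qed.

Theorem theorem3p5 (R : realType) (m n : nat) (m_gt0 : (0 < m)%N)
    (n_gt0 : (0 < n)%N) (A B : 'M[R]_(m, n))
    (hM : exists2 M : 'M[R]_m, M \in unitmx &
            spectral_norm (M *m B) < sigma (minn m n) (M *m A)) :
  [/\ (m < n)%N ->
        forall b : 'cV[R]_m, exists x : 'cV[R]_n, A *m x - B *m absmx x = b,
      m = n ->
        forall b : 'cV[R]_m, exists! x : 'cV[R]_n, A *m x - B *m absmx x = b
    & (n < m)%N ->
        forall b : 'cV[R]_m, solution_set A B b !=set0 ->
          exists x : 'cV[R]_n, solution_set A B b = [set x]].
Proof.
have [M Mu gap] := hM.
have exi : (m <= n)%N -> forall b : 'cV[R]_m,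
    exists x : 'cV[R]_n, A *m x - B *m absmx x = b.
  by move=> mn b; apply: ave_solvable gap => //; rewrite m_gt0.
have uni : (n <= m)%N -> forall x y : 'cV[R]_n,
    A *m x - B *m absmx x = A *m y - B *m absmx y -> x = y.
  by move=> nm x y; apply: ave_injective gap => //; rewrite n_gt0.
split=> [/ltnW/exi //|mn b|/ltnW nm b [x xS]].
  have [x xb] := exi (eq_leq mn) b; exists x; split=> // y yb.
  by apply: (uni (eq_leq (esym mn))); rewrite xb.
exists x; apply/seteqP; split=> y /=; last by move->.
by move=> yb; apply: (uni nm); rewrite yb xS.
Qed.
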